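(* Let $M$ be a simple matroid on a finite ground set $E$ with closure operator $\operatorname{cl}$ and set of circuits $\mathcal{C}$. If $M$ has a minimal tropical basis $\mathcal{C}'$ which contains a circuit $C$ with $\operatorname{cl}(C) \neq C$, then $\mathcal{C}'$ is not the unique minimal tropical basis of $M$, i.e., $M$ has a minimal tropical basis different from $\mathcal{C}'$.
   Context: A subset $\mathcal{C}' \subseteq \mathcal{C}$ is a tropical basis of $M$ if for every $X \subseteq E$ with $X \neq \operatorname{cl}(X)$ there exists $C \in \mathcal{C}'$ with $|C \setminus X| = 1$. A tropical basis $\mathcal{C}'$ is minimal if for every $C \in \mathcal{C}'$ the family $\mathcal{C}' \setminus \{C\}$ is not a tropical basis. *)

(* Defs.v *)
From HB Require Import structures.
From mathcomp Require Import all_boot.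
Set Implicit Arguments.
Unset Strict Implicit.
Unset Printing Implicit Defensive.

(** Matroids whose ground set is the finite type [E], given by their
    independent sets. *)
Record matroid (E : finType) := Matroid {
  indep : {set {set E}};
  indep_set0 : set0 \in indep;
  indep_sub : forall I J : {set E}, J \in indep -> I \subset J -> I \in indep;
  indep_aug : forall I J : {set E}, I \in indep -> J \in indep -> #|I| < #|J| ->
    exists2 e, e \in J :\: I & e |: I \in indep }.

Section MatroidNotions.
Variables (E : finType) (M : matroid E).
Implicit Types (X C : {set E}) (B : {set {set E}}).

Definition circuits : {set {set E}} :=
  [set C | minset (fun X => X \notin indep M) C].

Definition rank X : nat := \max_(I in indep M | I \subset X) #|I|.

Definition cl X : {set E} := [set e | rank (e |: X) == rank X].

Definition loop (e : E) : Prop := [set e] \in circuits.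

Definition parallel (e f : E) : Prop := e != f /\ [set e; f] \in circuits.

Definition simple : Prop :=
  (forall e, ~ loop e) /\ (forall e f, ~ parallel e f).

Definition tropical_basis B : Prop :=
  B \subset circuits /\
  forall X, X <> cl X -> exists2 C, C \in B & #|C :\: X| = 1.

Definition minimal_tropical_basis B : Prop :=
  tropical_basis B /\ forall C, C \in B -> ~ tropical_basis (B :\ C).

End MatroidNotions.

(* Main.v *)
(** It suffices to show that the circuits other than [C] form a tropical basis:
    a minimal tropical basis inside it misses [C].  Suppose that [C] is the
    circuit serving a non-closed [X], with [C :\: X = [set e]], and pick
    [f] in [cl C] outside [C].  If [f] is not in [X], a circuit through [f] in
    [f |: (C :\ e)] serves [X].  If [f] is in [X], exchange [f] for an element
    of the independent set [C :\ e] (possible as [f] is not a loop); the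
    resulting independent set still spans [e], so it yields a circuit through
    [e] that serves [X] and is not [C]. *)
Require Import Defs.
From mathcomp Require Import all_boot.

Section Matroid.
Set Implicit Arguments.
Unset Strict Implicit.
Variables (E : finType) (M : matroid E).
Implicit Types (X C I J : {set E}) (B : {set {set E}}).

Lemma circuit_dep C : C \in circuits M -> C \notin indep M.
Proof. by rewrite inE => /minsetP[]. Qed.

Lemma circuitD1_indep C e : C \in circuits M -> e \in C -> C :\ e \in indep M.
Proof.
rewrite inE => /minsetP[_ minC] eC; apply/negPn/negP => depCe.
have /setP/(_ e) := minC _ depCe (subsetDl _ _).
by rewrite !inE eqxx eC.
Qed.

(** A minimal dependent subset of [e |: I] must contain [e], since otherwise it would lie in the
    independent set [I]. *)
Lemma fundamental_circuit I e : I \in indep M -> e |: I \notin indep M ->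
  exists C, [/\ C \in circuits M, e \in C & C \subset e |: I].
Proof.
move=> indI /(minset_exists (P := fun X => X \notin indep M))[C minC sCeI].
exists C; split=> //; first by rewrite inE.
apply/negPn/negP => eNC; case/minsetP: minC => /negP depC _; apply: depC.
apply: indep_sub indI _; apply/subsetP => x xC.
have := subsetP sCeI x xC; rewrite !inE => /predU1P[xe|//].
by rewrite -xe xC in eNC.
Qed.

(** Augment [I] from [J] one element at a time, by induction on the deficit [#|J| - #|I|]. Applied
    to a singleton [I], this yields the exchange. *)
Lemma indep_extend I J : I \in indep M -> J \in indep M -> #|I| <= #|J| ->
  exists K, [/\ K \in indep M, I \subset K, K \subset I :|: J & #|K| = #|J|].
Proof.
move=> + indJ; have [n leJ] := ubnP (#|J| - #|I|).
elim: n I leJ => // n IHn I leJ indI.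
rewrite leq_eqVlt => /predU1P[eqIJ | ltIJ].
  by exists I; split=> //; apply: subsetUl.
have [e /setDP[eJ eNI] indeI] := indep_aug indI indJ ltIJ.
have card_eI : #|e |: I| = #|I|.+1 by rewrite cardsU1 eNI.
have [||K [indK sK sKJ cardK]] := IHn (e |: I) _ indeI.
- by rewrite card_eI subnS prednK ?subn_gt0.
- by rewrite card_eI.
exists K; split=> //; first exact: subset_trans (subsetUr _ _) sK.
by apply: subset_trans sKJ _; rewrite !subUset sub1set inE eJ orbT subsetUl subsetUr.
Qed.

Lemma indep_le_rank I X : I \in indep M -> I \subset X -> #|I| <= rank M X.
Proof.
by move=> indI sIX; apply: (leq_bigmax_cond (F := fun I => #|I|)); apply/andP.
Qed.

Lemma rank_dep_lt X : X \notin indep M -> rank M X < #|X|.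
Proof.
move=> depX; have X_gt0 : 0 < #|X|.
  by rewrite card_gt0; apply: contraNneq depX => ->; apply: indep_set0.
(* The maximum is bounded by [#|X|.-1], a true predecessor because [X] is nonempty. *)
rewrite -(prednK X_gt0) ltnS; apply/bigmax_leqP => I /andP[indI sIX].
rewrite -ltnS prednK //; apply: proper_card; rewrite properEneq sIX andbT.
by apply: contraNneq depX => <-.
Qed.

Lemma sub_cl X : X \subset cl M X.
Proof.
apply/subsetP => x xX; rewrite inE; suff -> : x |: X = X by [].
by apply/setUidPr; rewrite sub1set.
Qed.

Lemma simple_indep1 e : simple M -> [set e] \in indep M.
Proof.
case=> noloop _; apply/negPn/negP => dep_e; apply: (noloop e).
rewrite /loop inE; apply/minsetP; split=> // X depX.
by rewrite subset1 => /orP[/eqP // | /eqP X0]; rewrite X0 indep_set0 in depX.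
Qed.

(** Both replacement circuits are shown to serve [X] in this way, with [f] and then [e] as the
    element outside [X]. *)
Lemma cardsD_eq1 C X e : C \subset e |: X -> e \in C -> e \notin X ->
  #|C :\: X| = 1.
Proof.
move=> sC eC eNX; suff -> : C :\: X = [set e] by rewrite cards1.
apply/eqP; rewrite eqEsubset sub1set inE eC eNX !andbT.
by rewrite subDset setUC.
Qed.

Lemma nonclosed_circuit_replace C X : simple M -> C \in circuits M ->
  cl M C <> C -> #|C :\: X| = 1 ->
  exists2 C', C' \in circuits M :\ C & #|C' :\: X| = 1.
Proof.
move=> simM circC clC /eqP/cards1P[e CXe].
have /setDP[eC eNX] : e \in C :\: X by rewrite CXe set11.
have sCX : C :\ e \subset X.
  by rewrite subDset setUC -subDset CXe.
have /subsetPn[f fcl fNC] : ~~ (cl M C \subset C).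
  by apply/negP => s; apply: clC; apply/eqP; rewrite eqEsubset s sub_cl.
(* As [f] lies in [cl M C], the rank of [f |: C] is that of [C], which is below [#|C|]; so size
   alone forces dependence. *)
have dep_fC I : I \subset f |: C -> #|C| <= #|I| -> I \notin indep M.
  move=> sI leCI; apply/negP => /indep_le_rank/(_ sI).
  move: fcl; rewrite inE => /eqP -> leI.
  by have := rank_dep_lt (circuit_dep circC); rewrite ltnNge (leq_trans leCI).
have indCe := circuitD1_indep circC eC.
have cardC : #|C| = #|C :\ e|.+1 by rewrite (cardsD1 e C) eC.
have [fX | fNX] := boolP (f \in X); last first.
  have [||C' [circC' fC' sC']] := @fundamental_circuit (C :\ e) f => //.
    apply: dep_fC; first by rewrite setUS ?subsetDl.
    by rewrite cardsU1 cardC !inE (negPf fNC) andbF.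
  exists C'; first by rewrite !inE in circC' *; rewrite circC' andbT;
    apply: contraNneq fNC => <-.
  by apply: cardsD_eq1 fC' fNX; apply: subset_trans sC' (setUS _ _).
have indf := simple_indep1 f simM.
(* Otherwise [C] would be [[set e]], which is independent by simplicity. *)
have Ce_gt0 : #|[set f]| <= #|C :\ e|.
  rewrite cards1 lt0n; apply/negP; rewrite cards_eq0 => /eqP Ce0.
  by case/negP: (circuit_dep circC); rewrite -(setD1K eC) Ce0 setU0 simple_indep1.
have [J [indJ fJ sJ cardJ]] := indep_extend indf indCe Ce_gt0.
rewrite sub1set in fJ.
have sJX : J \subset X by apply: subset_trans sJ _; rewrite subUset sub1set fX.
have eNJ : e \notin J by apply: contra eNX; apply: (subsetP sJX).
(* [e |: J] lies in [f |: C] and has [#|C|] elements, so it is dependent. *)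
have [||C' [circC' eC' sC']] := @fundamental_circuit J e => //.
  apply: dep_fC; last by rewrite cardsU1 eNJ cardJ cardC.
  rewrite subUset sub1set !inE eC orbT; apply: subset_trans sJ _.
  by rewrite setUS ?subsetDl.
exists C'; last by apply: cardsD_eq1 eC' eNX; apply: subset_trans sC' (setUS _ _).
(* If [C'] were [C], then [C :\ e] would lie in [J], hence equal it by cardinality, putting [f] in
   [C]. *)
rewrite in_setD1 circC' andbT; apply/eqP => eqC'; move: sC'; rewrite eqC' -subDset => sCJ.
have /eqP eqCJ : C :\ e == J by rewrite eqEcard sCJ cardJ leqnn.
by move: fJ; rewrite -eqCJ !inE (negPf fNC) andbF.
Qed.

(** The boolean form lets [minset] range over tropical bases. *)
Lemma tropical_basisP B :
  reflect (tropical_basis M B)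
    ((B \subset circuits M) &&
     [forall (X | X != cl M X), exists C in B, #|C :\: X| == 1]).
Proof.
apply: (iffP andP) => -[sB trB]; split=> //.
  move=> X /eqP clX; have /exists_inP[C CB /eqP] := forall_inP trB X clX.
  by exists C.
apply/forall_inP => X /eqP/trB[C CB CX]; apply/exists_inP.
by exists C => //; apply/eqP.
Qed.

Lemma minimal_tropical_basis_exists B : tropical_basis M B ->
  exists2 B', minimal_tropical_basis M B' & B' \subset B.
Proof.
move=> /tropical_basisP/(minset_exists (P := fun B : {set {set E}} =>
  (B \subset circuits M) &&
  [forall (X | X != cl M X), exists C in B, #|C :\: X| == 1]))[B' minB' sB'].
exists B' => //; case/minsetP: minB' => /tropical_basisP trB' minB'.
(* Inclusion-minimality would force [B' :\ C] to equal [B'], although [C] is in [B']. *)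
split=> // C CB' /tropical_basisP/minB'/(_ (subsetDl _ _))/setP/(_ C).
by rewrite !inE eqxx CB'.
Qed.

End Matroid.

Theorem theorem3 (E : finType) (M : matroid E) (B : {set {set E}}) :
  simple M ->
  minimal_tropical_basis M B ->
  (exists2 C : {set E}, C \in B & cl M C <> C) ->
  exists2 B' : {set {set E}}, minimal_tropical_basis M B' & B' <> B.
Proof.
move=> simM [[sB trB] _] [C CB clC].
have trC : tropical_basis M (circuits M :\ C).
  split=> [|X /trB[D DB DX]]; first exact: subsetDl.
  have [eqDC | neqDC] := eqVneq D C.
    by apply: nonclosed_circuit_replace => //; [apply: (subsetP sB) | rewrite -eqDC].
  by exists D => //; rewrite in_setD1 neqDC (subsetP sB).
have [B' minB' sB'] := minimal_tropical_basis_exists trC.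
exists B' => // eqB; move: CB; rewrite -eqB => /(subsetP sB').
by rewrite in_setD1 eqxx.
Qed.
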